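(* Let $n\geq 13$, let $S_n$ be the symmetric group of degree $n$, let $S=\{c_n=(1\ 2\ \cdots\ n),c_n^{-1},(1\ 2)\}$, and let $\Gamma_n=\mathrm{Cay}(S_n,S)$. Then $$\mathrm{Aut}(\Gamma_n)=R(S_n)\rtimes\mathrm{Aut}(S_n,S)=R(S_n)\rtimes\langle\mathrm{Inn}(\phi)\rangle\cong S_n\rtimes\mathbb{Z}_2,$$ where $\phi=(1\ 2)(3\ n)(4\ n-1)(5\ n-2)\cdots\in S_n$ is the permutation with $\phi(1)=2$, $\phi(2)=1$, $\phi(i)=n+3-i$ for $3\le i\le n$, and $\mathrm{Inn}(\phi)$ is the inner automorphism of $S_n$ given by conjugation by $\phi$.
   Context: For a finite group $G$ and a subset $S\subseteq G$ with $e\notin S$ and $S=S^{-1}$, the Cayley graph $\mathrm{Cay}(G,S)$ is the undirected graph with vertex set $G$ in which $g,h$ are adjacent iff $hg^{-1}\in S$; $\mathrm{Aut}(\mathrm{Cay}(G,S))$ denotes its full automorphism group. The right regular representation of $G$ is $R(G)=\{r_g:x\mapsto xg\mid g\in G\}$, a subgroup of $\mathrm{Aut}(\mathrm{Cay}(G,S))$. $\mathrm{Aut}(G,S)=\{\sigma\in\mathrm{Aut}(G): S^\sigma=S\}$, which acts on $G$ and hence is regarded as a subgroup of $\mathrm{Aut}(\mathrm{Cay}(G,S))$ fixing $e$. *)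

(* Defs.v *)
From mathcomp Require Import all_boot all_fingroup zmodp.

Set Implicit Arguments.
Unset Strict Implicit.
Unset Printing Implicit Defensive.

Local Open Scope group_scope.

Section Graph.

Variable T : finType.

Definition graph_aut (e : rel T) : {set {perm T}} :=
  [set p : {perm T} | [forall x, forall y, e (p x) (p y) == e x y]].

Lemma graph_autP e (p : {perm T}) :
  reflect (forall x y, e (p x) (p y) = e x y) (p \in graph_aut e).
Proof.
rewrite inE; apply: (iffP forallP) => H x; last by apply/forallP => y; rewrite H.
by move=> y; move/forallP/(_ y)/eqP: (H x).
Qed.

Lemma graph_aut_group_set e : group_set (graph_aut e).
Proof.
apply/group_setP; split=> [|p q /graph_autP Hp /graph_autP Hq].
  by apply/graph_autP => x y; rewrite !perm1.
by apply/graph_autP => x y; rewrite !permM Hq Hp.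
Qed.

Canonical graph_aut_group e := Group (graph_aut_group_set e).

End Graph.

Section Cayley.

Variable gT : finGroupType.
Implicit Types S : {set gT}.

Definition cayley S : rel gT := fun g h => h * g^-1 \in S.

Lemma cayley_irrefl S : 1 \notin S -> irreflexive (cayley S).
Proof. by move=> S1 g; rewrite /cayley mulgV (negPf S1). Qed.

Lemma cayley_sym S : S^-1 = S -> symmetric (cayley S).
Proof. by move=> SV g h; rewrite /cayley -{1}SV inE invMg invgK. Qed.

(* [perm (mulIg g)] is the permutation [x |-> x * g]. *)
Definition right_regular : {set {perm gT}} :=
  [set perm (@mulIg gT g) | g : gT].

Lemma right_regular_group_set : group_set right_regular.
Proof.
apply/group_setP; split=> [|_ _ /imsetP[g _ ->] /imsetP[h _ ->]].
  by apply/imsetP; exists 1 => //; apply/permP => x; rewrite perm1 permE mulg1.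
apply/imsetP; exists (g * h) => //.
by apply/permP => x; rewrite permM !permE mulgA.
Qed.

Canonical right_regular_group := Group right_regular_group_set.

Definition Aut_stab S : {set {perm gT}} :=
  [set s in Aut [set: gT] | s @: S == S].

Lemma Aut_stab_group_set S : group_set (Aut_stab S).
Proof.
apply/group_setP; split=> [|p q].
  rewrite inE group1 -[X in _ == X]imset_id.
  by apply/eqP/eq_imset => x; rewrite perm1.
rewrite ![_ \in Aut_stab S]inE => /andP[Ap /eqP Sp] /andP[Aq /eqP Sq].
rewrite groupM //=; apply/eqP; rewrite -[RHS]Sq -[in RHS]Sp -imset_comp.
by apply: eq_imset => x; rewrite /= permM.
Qed.

Canonical Aut_stab_group S := Group (Aut_stab_group_set S).

End Cayley.

Section Involution.

(* The action of [Z_2] on [gT] whose generator acts as conjugation by [t],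
   for [t] with [t ^+ 2 = 1]. *)
Variables (gT : finGroupType) (t : gT) (t2 : t ^+ 2 = 1).

Definition Z2_conj (x : gT) (a : 'Z_2) : gT := x ^ (t ^+ a).

Lemma Z2_conj_is_action : is_action [set: 'Z_2] Z2_conj.
Proof.
apply: is_total_action => [x | x a b]; first by rewrite /Z2_conj expg0 conjg1.
by rewrite /Z2_conj -conjgM -expgD /= expg_mod.
Qed.

Canonical Z2_conj_action := Action Z2_conj_is_action.

Lemma Z2_conj_is_groupAction : is_groupAction [set: gT] Z2_conj_action.
Proof.
move=> a _; rewrite inE; apply/andP; split.
  by apply/subsetP => x _; rewrite inE.
by apply/morphicP => x y _ _; rewrite !actpermE /= /Z2_conj conjMg.
Qed.

Canonical Z2_conj_groupAction := GroupAction Z2_conj_is_groupAction.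

End Involution.

(* The points 1, ..., n are represented by the ordinals 0, ..., n - 1. *)
Section Symmetric.

Variable n : nat.

Definition ncycle : 'S_n := perm (@ordS_inj n).

(* The transposition (1 2); the second branch is only reached when n < 2. *)
Definition transp12 : 'S_n :=
  if n is m.+2 return 'S_n then tperm (inord 0) (inord 1) else 1.

Definition conn_set : {set 'S_n} := [set ncycle; ncycle^-1; transp12].

(* phi(i) = n + 3 - i on {3, ..., n} reads i |-> n + 1 - i on {2, ..., n - 1}.
   For n >= 2 the value always lies in 'I_n, so that [insubd] never defaults. *)
Definition phi_fun (i : 'I_n) : 'I_n :=
  insubd i (if i < 2 then 1 - i else n + 1 - i).

Lemma val_phi_fun (i : 'I_n) :
  1 < n -> phi_fun i = (if i < 2 then 1 - i else n + 1 - i) :> nat.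
Proof.
move=> n2; rewrite val_insubd ifT //; have lin := ltn_ord i.
case: (ltnP i 2) => i2; first exact: leq_ltn_trans (leq_subr _ _) n2.
rewrite ltn_subLR; last by rewrite (leq_trans (ltnW lin)) ?leq_addr.
by rewrite addnC ltn_add2r.
Qed.

Lemma phi_funK : involutive phi_fun.
Proof.
case: (ltnP 1 n) => n2 i; apply: val_inj => /=; last first.
  have lin := ltn_ord i; have/eqP i0: i == 0 :> nat.
    by rewrite -leqn0 -ltnS (leq_trans lin).
  have E (j : 'I_n) : j = i.
    apply: val_inj => /=; apply/eqP; rewrite i0 -leqn0 -ltnS.
    exact: leq_trans (ltn_ord j) n2.
  by rewrite (E (phi_fun _)).
rewrite !val_phi_fun //; have lin := ltn_ord i; case: (ltnP i 2) => i2.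
  by case: (nat_of_ord i) i2 => [|[|]].
have -> : (n + 1 - i < 2) = false.
  by apply/negbTE; rewrite -leqNgt ltn_subRL ltn_add2r.
by rewrite subKn // addn1 leqW // ltnW.
Qed.

Definition phi : 'S_n := perm (inv_inj phi_funK).

Lemma phi2 : phi ^+ 2 = 1.
Proof. by apply/permP => i; rewrite expgS expg1 permM !permE phi_funK. Qed.

Lemma conn_setV : conn_set^-1 = conn_set.
Proof.
have tV : transp12^-1 = transp12.
  rewrite /transp12; case: (n) => [|[|m]]; rewrite ?invg1 //; exact: tpermV.
apply/setP => s; rewrite mem_invg !inE ![s^-1 == _](inv_eq invgK) invgK tV.
by case: (s == ncycle); rewrite ?orbT ?orbF.
Qed.

End Symmetric.

Lemma conn_set1 n : 2 < n -> 1 \notin conn_set n.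
Proof.
case: n => [|[|n]] // n2.
have c1 : 1 != ncycle n.+2.
  apply/eqP => /permP/(_ ord0)/(congr1 val); rewrite perm1 permE /=.
  by rewrite modn_small.
rewrite !inE !negb_or c1 [1 == _^-1]eq_sym eq_invg1 eq_sym c1 /=.
apply/eqP => /permP/(_ (inord 0))/(congr1 val); rewrite perm1 tpermL.
by rewrite /= !inordK.
Qed.

(* Main.v *)
(** Write c for the n-cycle and t for (1 2). As n >= 13, a word of length at
    most 12 in c, c^-1 and t cannot wind around the n-cycle, so whether it is
    trivial does not depend on n and is decided by finitely many computations.
    Through each ordered corner formed by a t-edge and a c-edge pass at least
    two reduced closed walks of length 12, rotations of (t c t c^-1)^3 and of
    (t c^2 t c^-2)^2, but only one passes through an ordered corner formed by
    two c-edges, a rotation of the latter; hence every graph automorphism f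
    maps t-edges to t-edges, and at each vertex f either preserves or reverses
    the direction of the c-edges. A closed walk t c^e1 t c^e2 ... t c^e6 = 1
    forces e1 = - e6, so this choice propagates along t-edges, and by
    connectedness it is the same at all vertices. In the first case
    f(g) = g f(1), in the second f(g) = g^phi f(1). *)
Require Import Defs.
From mathcomp Require Import all_boot all_fingroup zmodp zify.

Set Implicit Arguments.
Unset Strict Implicit.
Unset Printing Implicit Defensive.

Local Open Scope group_scope.

(** * Right translations, group automorphisms and their semidirect product *)

Section CayleyGroups.

Variable gT : finGroupType.
Implicit Types (S : {set gT}) (t : gT).

Lemma conj_autTE t g : conj_aut [set: gT] t g = g ^ t.
Proof. by rewrite conj_autE ?inE. Qed.

Lemma AutTM (a : {perm gT}) : a \in Aut [set: gT] -> {morph a : x y / x * y}.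
Proof. by move/Aut_morphic/morphicP=> aM x y; rewrite aM ?inE. Qed.

Lemma AutT1 (a : {perm gT}) : a \in Aut [set: gT] -> a 1 = 1.
Proof. by move=> /AutTM aM; apply: (mulgI (a 1)); rewrite -aM !mulg1. Qed.

Lemma right_mulE (g x : gT) : perm (@mulIg gT g) x = x * g.
Proof. exact: permE. Qed.

Lemma right_regular_sub_graph_aut S :
  right_regular gT \subset graph_aut (cayley S).
Proof.
apply/subsetP => _ /imsetP[g _ ->]; apply/graph_autP => x y.
by rewrite /cayley !permE invMg mulgA mulgK.
Qed.

Lemma Aut_stab_sub_graph_aut S : Aut_stab S \subset graph_aut (cayley S).
Proof.
apply/subsetP => a; rewrite inE => /andP[Aa /eqP aS]; apply/graph_autP => x y.
have aV : a x^-1 = (a x)^-1.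
  by apply/eqP; rewrite eq_sym eq_invg_mul -AutTM // mulgV AutT1.
by rewrite /cayley -aV -AutTM // -{1}aS mem_imset //; apply: perm_inj.
Qed.

Lemma Aut_stab_norm_right_regular S :
  Aut_stab S \subset 'N(right_regular gT).
Proof.
apply/subsetP => a; rewrite inE => /andP[Aa _]; rewrite inE.
apply/subsetP => _ /imsetP[_ /imsetP[g _ ->] ->].
apply/imsetP; exists (a g) => //; apply/permP => x.
by rewrite conjgE !permM !right_mulE AutTM // permKV.
Qed.

Lemma right_regular_Aut_stab_TI S : right_regular gT :&: Aut_stab S = 1.
Proof.
apply/trivgP/subsetP => _ /setIP[/imsetP[g _ ->]].
rewrite inE => /andP[/AutT1 + _]; rewrite permE mul1g => ->.
by apply/set1P/permP => x; rewrite permE perm1 mulg1.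
Qed.

Definition right_mul (g : gT) : {perm gT} := perm (@mulIg gT g).

Lemma right_mulM : {in [set: gT] &, {morph right_mul : x y / x * y}}.
Proof. by move=> g h _ _; apply/permP => x; rewrite permM !permE mulgA. Qed.

Canonical right_mul_morphism := Morphism right_mulM.

Lemma injm_right_mul : 'injm right_mul.
Proof.
apply/injmP => g h _ _ /permP/(_ 1).
by rewrite !permE !mul1g.
Qed.

Lemma im_right_mul : right_mul @* [set: gT] = right_regular gT.
Proof.
rewrite morphimEdom; apply/setP => p.
by apply/imsetP/imsetP => -[g _ ->]; exists g; rewrite ?inE.
Qed.

Section Z2.

Variables (t : gT) (t2 : t ^+ 2 = 1).

Local Notation s := (conj_aut [set: gT] t).

Lemma conj_aut_sqr : s ^+ 2 = 1.
Proof.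
apply/permP => x; rewrite expgS expg1 permM !conj_autTE -conjgM -expg2 t2.
by rewrite conjg1 perm1.
Qed.

Definition Z2_conj_aut (a : 'Z_2) : {perm gT} := s ^+ a.

Lemma Z2_conj_autM : {in [set: 'Z_2] &, {morph Z2_conj_aut : a b / a * b}}.
Proof.
by move=> a b _ _; rewrite /Z2_conj_aut /= expg_mod ?expgD // conj_aut_sqr.
Qed.

Canonical Z2_conj_aut_morphism := Morphism Z2_conj_autM.

Lemma injm_Z2_conj_aut : s != 1 -> 'injm Z2_conj_aut.
Proof.
move=> s1; apply/subsetP => a /morphpreP[_ /set1P].
case: a => [[|[|]] // a2] E; rewrite inE; first by apply/eqP; apply: val_inj.
by move: s1; rewrite -[s]expg1 -/(Z2_conj_aut (Ordinal a2)) E eqxx.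
Qed.

Lemma im_Z2_conj_aut : Z2_conj_aut @* [set: 'Z_2] = <[s]>.
Proof.
apply/eqP; rewrite eqEsubset cycle_subG; apply/andP; split.
  by apply/subsetP => _ /morphimP[a _ _ ->]; apply: mem_cycle.
exact: (mem_morphim Z2_conj_aut_morphism (in_setT (Zp1 : 'Z_2)) (in_setT _)).
Qed.

(** Conjugating the right translation by g with an automorphism [a] gives the right translation by
    [a g]; this is the compatibility that [xsdprodm] requires to glue the two embeddings into one
    morphism. *)
Lemma Z2_conj_morph_act :
  {in [set: gT] & [set: 'Z_2],
     morph_act (Z2_conj_groupAction t2) 'J right_mul Z2_conj_aut}.
Proof.
move=> g a _ _; apply/permP => x; rewrite /= conjgE !permM !right_mulE.
have sX y k : (s ^+ k) y = y ^ (t ^+ k).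
  elim: k y => [|k IH] y; first by rewrite perm1 conjg1.
  by rewrite expgS permM IH conj_autTE -conjgM -expgS.
by rewrite /Z2_conj_aut -[X in X * _](permKV (s ^+ a) x) !sX conjMg.
Qed.

Lemma right_regular_sdprod_isog (G : {group {perm gT}}) :
  s != 1 -> right_regular gT ><| <[s]> = G ->
  G \isog [set: sdprod_by (Z2_conj_groupAction t2)].
Proof.
move=> s1 defG; have [_ defM _ tiRs] := sdprodP defG.
have inj : 'injm (xsdprodm Z2_conj_morph_act).
  rewrite injm_xsdprodm injm_right_mul injm_Z2_conj_aut //=.
  by rewrite im_right_mul im_Z2_conj_aut; apply/eqP.
have <- : xsdprodm Z2_conj_morph_act @* setT = G.
  by rewrite im_xsdprodm im_right_mul im_Z2_conj_aut.
by rewrite isog_sym; apply: sub_isog.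
Qed.

End Z2.

End CayleyGroups.

(** * Reduced words and an evaluation uniform in n *)

(* [None] stands for t, [Some true] for c and [Some false] for c^-1. *)
Definition letter := option bool.

Definition linv (x : letter) : letter := omap negb x.

Definition reduced_step (x y : letter) := y != linv x.

(** The explicit conditional keeps call-by-value evaluation out of the pruned branches, where [||]
    would compute both sides. *)
Fixpoint all_reduced k x (P : pred (seq letter)) : bool :=
  if k is k'.+1 then
    all (fun y => if y == linv x then true
                  else all_reduced k' y (fun w => P (y :: w)))
        [:: None; Some true; Some false]
  else P [::].

Lemma all_reducedP k x (P : pred (seq letter)) w :
  all_reduced k x P -> size w = k -> path reduced_step x w -> P w.
Proof.
elim: k x P w => [|k IH] x P [|y w] // /allP allx [sz] /andP[xy yw].
apply: (IH y (fun w => P (y :: w))) => //.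
have := allx y; rewrite (negPf xy); apply.
by case: (y) => [[]|].
Qed.

(* The natural number p represents the point p - 12 modulo n. A step is
   undefined when it leaves the window in which, for every n >= 13, only 12 and
   13 represent the two points moved by t. *)
Definition sim_step (x : letter) (p : nat) : option nat :=
  match x with
  | Some true => Some p.+1
  | Some false => if p is q.+1 then Some q else None
  | None => if 0 < p < 25
            then Some (if p == 12 then 13 else if p == 13 then 12 else p)
            else None
  end.

Fixpoint sim (w : seq letter) p :=
  if w is x :: w' then obind (sim_step x) (sim w' p) else Some p.

(* The bounds ensure that p and q stay different modulo every n >= 13. *)
Definition moves_at w p :=
  if sim w p is Some q then [&& q != p, q < p + 13 & p < q + 13] else false.

Fixpoint moves_in w k :=
  if k is k'.+1 then if moves_at w k then true else moves_in w k' else false.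

(** The starting positions 1 to 25 represent the points -11 to 13. Success certifies that w acts
    nontrivially for every n >= 13; failure certifies nothing. *)
Definition moves w := moves_in w 25.

(** A rotation of (t c^2 t c^-2)^2, or of its analogue with c inverted, cut in the middle of a
    square: the closed walk leaves and re-enters its base vertex by two different c-edges. *)
Definition turn_word b : seq letter :=
  let c := Some b in let d := Some (~~ b) in
  [:: c; None; d; d; None; c; c; None; d; d; None; c].

(** An exhaustive search: after the first letter, each of the other 11 has two reduced choices,
    which leaves 2^11 words. *)
Lemma turn_word_unique_check b :
  all_reduced 11 (Some b) (fun w =>
    if last (Some b) w == Some b then
      if Some b :: w == turn_word b then true else moves (Some b :: w)
    else true).
Proof. by case: b; vm_cast_no_check (erefl true). Qed.

Definition alternating_word e1 e2 e3 e4 e5 e6 : seq letter :=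
  [:: None; Some e1; None; Some e2; None; Some e3;
      None; Some e4; None; Some e5; None; Some e6].

Lemma alternating_word_moves e1 e2 e3 e4 e5 :
  moves (alternating_word e1 e2 e3 e4 e5 e1).
Proof. by case: e1; case: e2; case: e3; case: e4; case: e5; vm_compute. Qed.

Lemma letters_move x y : x != y -> moves [:: x; linv y].
Proof. by case: x => [[]|]; case: y => [[]|]. Qed.

Lemma eqn_mod_near n p q :
  p = q %[mod n] -> p < q + n -> q < p + n -> p = q.
Proof.
wlog pq : p q / p <= q => [W|] E pqn qpn.
  by case: (leqP p q) => [|/ltnW] h; [apply: W | apply/esym/W].
have /dvdnP[[|k] Eqp] : n %| q - p by rewrite -eqn_mod_dvd //; apply/eqP.
  by apply/eqP; rewrite eqn_leq pq -subn_eq0 Eqp.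
by move: qpn; rewrite -ltn_subLR // Eqp mulSn ltnNge leq_addr.
Qed.

(** * Action of words in c and t on the n points *)

Section CayleyWords.

Variable n : nat.
Hypothesis hn : 13 <= n.

Local Notation c := (ncycle n).
Local Notation t := (transp12 n).

Definition letter_perm (x : letter) : 'S_n :=
  match x with None => t | Some true => c | Some false => c^-1 end.

(* The walk reading w from g ends at [word_perm w * g], since a step along x
   multiplies by the generator on the left: the first letter comes last. *)
Fixpoint word_perm (w : seq letter) : 'S_n :=
  if w is x :: w' then word_perm w' * letter_perm x else 1.

Lemma val_ncycle (i : 'I_n) : c i = i.+1 %% n :> nat.
Proof. by rewrite permE. Qed.

Lemma transp12E : exists2 z : 'I_n, z = 0 :> nat & t = tperm z (c z).
Proof.
rewrite /ncycle /transp12; case: n hn => [|[|m]] // hm.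
exists (inord 0); first by rewrite inordK.
by congr tperm; apply: val_inj; rewrite permE /= !inordK ?modn_small.
Qed.

Lemma val_transp12 (i : 'I_n) :
  t i = (if i == 0 :> nat then 1 else if i == 1%N :> nat then 0 else i)%N :> nat.
Proof.
have [z z0 ->] := transp12E.
have z1 : c z = 1%N :> nat by rewrite val_ncycle z0 modn_small // (leq_trans _ hn).
have iz : (i == 0%N :> nat) = (i == z) by rewrite -z0 val_eqE.
have ic : (i == 1%N :> nat) = (i == c z) by rewrite -z1 val_eqE.
rewrite iz ic; case: tpermP => [->|->|/eqP/negPf-> /eqP/negPf->] //.
  by rewrite eqxx.
by case: eqP => [<-|_]; rewrite ?eqxx ?z1.
Qed.

Lemma transp12V : t^-1 = t.
Proof. by have [z _ ->] := transp12E; rewrite tpermV. Qed.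

Lemma letter_perm_linv x : letter_perm (linv x) = (letter_perm x)^-1.
Proof. by case: x => [[]|] /=; rewrite ?invgK ?transp12V. Qed.

Lemma word_perm_rcons w x :
  word_perm (rcons w x) = letter_perm x * word_perm w.
Proof. by elim: w => [|y w IH] /=; rewrite ?mul1g ?mulg1 // IH mulgA. Qed.

Lemma sim_stepP x p q (i : 'I_n) :
  sim_step x p = Some q -> p = i + 12 %[mod n] ->
  q = letter_perm x i + 12 %[mod n].
Proof.
case: x => [[]|] /=.
- by case=> <- E; rewrite val_ncycle modnDml addSn -addn1 -modnDml E modnDml addn1.
- case: p => // p [<-] E; apply/eqP; rewrite -(eqn_modDr 1%N) !addn1; apply/eqP.
  by rewrite E -{1}[i](permKV c) val_ncycle modnDml addSn.
case: ifP => // /andP[p0 p25] [<-] E; rewrite val_transp12.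
have near j : j < 2 -> p = j + 12 %[mod n] -> p = j + 12.
  by move=> j2 /eqn_mod_near; apply; lia.
have ltin := ltn_ord i.
have [i0|i0] := eqVneq (nat_of_ord i) 0%N.
  by rewrite [in LHS](near 0) // E i0.
have [i1|i1] := eqVneq (nat_of_ord i) 1%N.
  by rewrite [in LHS](near 1%N) // E i1.
have [Ep|_] := eqVneq p 12.
  have E12 : p = i + 12 by apply: eqn_mod_near E _ _; lia.
  by move/eqP: i0; lia.
have [Ep|_] := eqVneq p 13 => //.
have E12 : p = i + 12 by apply: eqn_mod_near E _ _; lia.
by move/eqP: i1; lia.
Qed.

Lemma simP w p q (i : 'I_n) :
  sim w p = Some q -> p = i + 12 %[mod n] -> q = word_perm w i + 12 %[mod n].
Proof.
elim: w q => [|x w IH] q /=; first by case=> <-; rewrite perm1.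
case Ep' : (sim w p) => [p'|] //= Eq Ep; rewrite permM.
by apply: sim_stepP Eq _; apply: IH.
Qed.

Lemma moves_neq1 w : moves w -> word_perm w != 1.
Proof.
rewrite /moves; elim: 25 => // k IH /=; case: ifP => [mk _|_ /IH //].
move: mk; rewrite /moves_at; case Eq: sim => [q|] // /and3P[qp q_lt p_lt].
have n0 : 0 < n by apply: leq_trans hn.
(* This is the point k + 1 - 12 modulo n; adding [12 * n.-1] avoids the truncated subtraction of
   12. *)
pose i := Ordinal (ltn_pmod (k.+1 + 12 * n.-1) n0).
apply: contraNneq qp => w1.
have Ei : k.+1 = i + 12 %[mod n].
  by rewrite /= modnDml -addnA -mulnSr prednK // addnC modnMDl.
have := simP Eq Ei; rewrite w1 perm1 -Ei => /eqn_mod_near ->; lia.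
Qed.

Lemma letter_perm_inj : injective letter_perm.
Proof.
move=> x y Exy; apply/eqP/idPn => /letters_move/moves_neq1/eqP[].
by rewrite /= mul1g letter_perm_linv Exy mulVg.
Qed.

(** * Relations between c and t, and the closed walks they give *)

Lemma conj_transp12_cube e : (t ^ letter_perm (Some e) * t) ^+ 3 = 1.
Proof.
have Ht : (t ^ c * t) ^+ 3 = 1.
  have [z z0 ->] := transp12E; rewrite tpermJ.
  set y := c z; set x := c y.
  have y1 : y = 1%N :> nat by rewrite val_ncycle z0 modn_small; lia.
  have x2 : x = 2 :> nat by rewrite val_ncycle y1 modn_small; lia.
  have xz : z != x by rewrite -val_eqE /= z0 x2.
  have yz : z != y by rewrite -val_eqE /= z0 y1.
  have xy : y != x by rewrite -val_eqE /= y1 x2.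
  set a := tperm y x; set b := tperm z y.
  (* For involutions, (ab)^3 = (aba)(bab); here both factors are the transposition of z and x. *)
  have -> : (a * b) ^+ 3 = b ^ a * a ^ b.
    by rewrite !conjgE !tpermV !expgS expg0 mulg1 !mulgA.
  rewrite !tpermJ tpermL tpermR !tpermD //; last by rewrite eq_sym.
    by rewrite tperm2.
  by rewrite eq_sym.
case: e => //=.
(* Inverting and then conjugating by c^-1 turns the relation for c into the one for c^-1. *)
have -> : t ^ c^-1 * t = ((t ^ c * t)^-1) ^ c^-1.
  by rewrite invMg -conjVg transp12V conjMg conjgK.
by rewrite -conjXg expgVn Ht invg1 conj1g.
Qed.

Lemma conj2_transp12_sqr e : (t ^ (letter_perm (Some e) ^+ 2) * t) ^+ 2 = 1.
Proof.
have Ht : (t ^ (c ^+ 2) * t) ^+ 2 = 1.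
  have [z z0 ->] := transp12E; rewrite (expgS c) expg1 conjgM !tpermJ.
  set y := c z; set x := c y; set u := c x.
  have y1 : y = 1%N :> nat by rewrite val_ncycle z0 modn_small; lia.
  have x2 : x = 2 :> nat by rewrite val_ncycle y1 modn_small; lia.
  have u3 : u = 3 :> nat by rewrite val_ncycle x2 modn_small; lia.
  set a := tperm x u; set b := tperm z y.
  (* The supports {x, u} and {z, y} are disjoint, so [a ^ b] is a. *)
  have -> : (a * b) ^+ 2 = a * a ^ b.
    by rewrite !conjgE !tpermV !expgS expg0 mulg1 !mulgA.
  by rewrite !tpermJ !tpermD ?tperm2 // -val_eqE /= ?z0 ?y1 ?x2 ?u3.
case: e => //=.
have -> : t ^ (c^-1 ^+ 2) * t = ((t ^ (c ^+ 2) * t)^-1) ^ (c^-1 ^+ 2).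
  by rewrite invMg -conjVg transp12V conjMg expgVn conjgK.
by rewrite -conjXg expgVn Ht invg1 conj1g.
Qed.

Definition braid_word e := alternating_word e (~~ e) e (~~ e) e (~~ e).

Definition commutation_word e : seq letter :=
  let c := Some e in let d := Some (~~ e) in
  [:: None; c; c; None; d; d; None; c; c; None; d; d].

Lemma braid_word1 e : word_perm (braid_word e) = 1.
Proof.
rewrite -(conj_transp12_cube e) conjgE -letter_perm_linv !expgS expg0 mulg1.
by rewrite [braid_word e]/alternating_word /= mul1g !mulgA.
Qed.

Lemma commutation_word1 e : word_perm (commutation_word e) = 1.
Proof.
rewrite -(conj2_transp12_sqr e) conjgE -expgVn -letter_perm_linv.
by rewrite !expgS !expg0 !mulg1 /= mul1g !mulgA.
Qed.

Lemma turn_word_unique b w :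
  size w = 11 -> path reduced_step (Some b) w -> last (Some b) w = Some b ->
  word_perm (Some b :: w) = 1 -> Some b :: w = turn_word b.
Proof.
move=> sz red lw w1; have := all_reducedP (turn_word_unique_check b) sz red.
rewrite lw eqxx; case: eqP => // _ /moves_neq1.
by rewrite w1 eqxx.
Qed.

(** Each of the 32 words with equal first and last exponents moves a point. This is what later
    carries edge directions across t-edges. *)
Lemma alternating_word_closed e1 e2 e3 e4 e5 e6 :
  word_perm (alternating_word e1 e2 e3 e4 e5 e6) = 1 -> e1 = ~~ e6.
Proof.
move=> w1; have mw := moves_neq1 (alternating_word_moves e1 e2 e3 e4 e5).
apply/eqP; apply: contraNT mw => ne; rewrite -w1; suff -> : e1 = e6 by [].
by case: e1 e6 ne {w1} => [] [].
Qed.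

Lemma letter_perm_ind (P : 'S_n -> Prop) :
  P 1 -> (forall x h, P h -> P (letter_perm x * h)) -> forall h, P h.
Proof.
move=> P1 PM h.
have : h \in <<[set t; c]>>.
  suff -> : <<[set t; c]>> = [set: 'S_n] by rewrite inE.
  rewrite /ncycle /transp12; case: n hn => [|[|m]] // hm.
  (* The two points swapped by t are at distance 1, which is coprime to n; this is the condition for
     t and the shift to generate. *)
  have co : coprime m.+2 (@inord m.+1 1 - inord 0)%R.
    by rewrite /= !inordK // subn0 modnn addn0 modn_small // coprimen1.
  rewrite -(gen_tpermn_circular_shift co); congr (<<[set _; _]>>).
  by apply/permP => i; apply: val_inj; rewrite !permE /= add1n.
case/gen_prodgP=> k [a Ha ->]; elim: k a Ha => [|k IH] a Ha.
  by rewrite big_ord0.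
rewrite big_ord_recl; have /set2P[->|->] := Ha ord0.
  by apply: (PM None); apply: IH => i.
by apply: (PM (Some true)); apply: IH => i.
Qed.

(** * Conjugation by [phi] *)

Lemma phiV : (phi n)^-1 = phi n.
Proof. by apply/eqP; rewrite eq_invg_mul -(expgS _ 1) phi2. Qed.

Lemma val_phi (i : 'I_n) :
  phi n i = (if i < 2 then 1 - i else n + 1 - i)%N :> nat.
Proof. by rewrite permE val_phi_fun //; lia. Qed.

(** On 0, ..., n - 1 taken modulo n, [phi] is the reflection i |-> 1 - i, which reverses the
    rotation c and swaps 0 and 1. *)
Lemma ncycleJ_phi : c ^ phi n = c^-1.
Proof.
rewrite conjgE phiV; apply/eqP; rewrite eq_sym eq_invg_mul; apply/eqP.
have val_c (i : 'I_n) : c i = (if i.+1 == n then 0 else i.+1)%N :> nat.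
  rewrite val_ncycle; have := ltn_ord i.
  by case: eqP => [->|ne] ltin; rewrite ?modnn ?modn_small //; lia.
apply/permP => i; apply: ord_inj; rewrite !permM perm1.
rewrite val_phi val_c val_phi val_c; have := ltn_ord i.
by repeat case: ifP; lia.
Qed.

Lemma transp12J_phi : t ^ phi n = t.
Proof.
have [z z0 ->] := transp12E; rewrite tpermJ tpermC.
have z1 : c z = 1%N :> nat by rewrite val_ncycle z0 modn_small; lia.
by congr tperm; apply: ord_inj; rewrite val_phi ?z1 ?z0.
Qed.

(** * Labelled walks and their images under a graph automorphism *)

Local Notation adj := (cayley (conn_set n)).

Lemma cayleyP g h : reflect (exists x, h = letter_perm x * g) (adj g h).
Proof.
apply: (iffP idP) => [|[x ->]]; last first.
  by rewrite /cayley mulgK !inE; case: x => [[]|]; rewrite eqxx ?orbT.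
rewrite /cayley !inE -orbA => /or3P[] /eqP E.
- by exists (Some true); rewrite /= -E mulgKV.
- by exists (Some false); rewrite /= -E mulgKV.
- by exists None; rewrite /= -E mulgKV.
Qed.

(** On adjacent vertices the label exists and is unique by [letter_perm_inj]; the default [None]
    serves only non-adjacent pairs. *)
Definition edge_label g h : letter :=
  odflt None [pick x | h == letter_perm x * g].

Lemma edge_labelP g h : adj g h -> h = letter_perm (edge_label g h) * g.
Proof.
case/cayleyP=> x ->; rewrite /edge_label; case: pickP => [y /eqP // | /(_ x)].
by rewrite eqxx.
Qed.

Lemma edge_labelE g x : edge_label g (letter_perm x * g) = x.
Proof.
have /edge_labelP/mulIg/letter_perm_inj // : adj g (letter_perm x * g).
by apply/cayleyP; exists x.
Qed.

Section Automorphism.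

Variable f : {perm 'S_n}.
Hypothesis autf : f \in graph_aut adj.

Fixpoint image_word g (w : seq letter) : seq letter :=
  if w is x :: w' then
    let h := letter_perm x * g in edge_label (f g) (f h) :: image_word h w'
  else [::].

Lemma image_edge g x :
  f (letter_perm x * g)
  = letter_perm (edge_label (f g) (f (letter_perm x * g))) * f g.
Proof.
by apply: edge_labelP; rewrite (graph_autP _ _ autf); apply/cayleyP; exists x.
Qed.

Lemma size_image_word g w : size (image_word g w) = size w.
Proof. by elim: w g => //= x w IH g; rewrite IH. Qed.

Lemma word_perm_image g w :
  word_perm (image_word g w) * f g = f (word_perm w * g).
Proof.
by elim: w g => [|x w IH] g /=; rewrite ?mul1g // -!mulgA -image_edge IH.
Qed.

Lemma image_word_inj g : injective (image_word g).
Proof.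
move=> w1 w2; elim: w1 g w2 => [|x w1 IH] g [|y w2] //= [Exy].
have -> : x = y.
  have := image_edge g x; rewrite Exy -image_edge.
  by move=> /perm_inj/mulIg/letter_perm_inj.
by move/IH->.
Qed.

(** If the image backtracks, injectivity of f forces the two original steps to end where they began,
    so they backtrack as well. *)
Lemma image_word_reduced g x w : path reduced_step x w ->
  path reduced_step (edge_label (f g) (f (letter_perm x * g)))
                    (image_word (letter_perm x * g) w).
Proof.
elim: w g x => //= y w IH g x /andP[xy yw]; rewrite IH // andbT.
apply: contraNneq xy => E; have := image_edge (letter_perm x * g) y.
have := image_edge g x; move: E; set l := edge_label (f g) _ => -> Ex.
rewrite letter_perm_linv Ex mulKg => /perm_inj.
rewrite -[RHS](mulKg (letter_perm x)) -letter_perm_linv.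
by move/mulIg/letter_perm_inj->.
Qed.

Lemma image_word_rcons g w x :
  image_word g (rcons w x)
  = rcons (image_word g w)
      (edge_label (f (word_perm w * g)) (f (letter_perm x * (word_perm w * g)))).
Proof. by elim: w g => [|y w IH] g /=; rewrite ?mul1g // IH !mulgA. Qed.

(** The closed walk returns to g through the neighbour [letter_perm (linv x) * g], so the image of
    that neighbour determines the last letter of the image walk. *)
Lemma last_image_word g w x y z : word_perm (rcons w x) = 1 ->
  f (letter_perm (linv x) * g) = letter_perm (linv y) * f g ->
  last z (image_word g (rcons w x)) = y.
Proof.
rewrite word_perm_rcons => w1 Ey; rewrite image_word_rcons last_rcons mulgA w1.
have Ew : word_perm w = letter_perm (linv x).
  by rewrite letter_perm_linv; apply/eqP; rewrite eq_sym eq_invg_mul w1.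
have E : f g = letter_perm y * (letter_perm (linv y) * f g).
  by rewrite letter_perm_linv mulKVg.
by rewrite mul1g Ew Ey {2}E edge_labelE.
Qed.

Lemma image_transp12 g : f (t * g) = t * f g.
Proof.
have := image_edge g None; set l := edge_label _ _.
case El : l => [b|] fb; last exact: fb.
(* The other c-edge at [f g] must come from a c-edge at g, because [t * g] already goes to the end
   of the c^b-edge. *)
have [e fe] : exists e,
    f (letter_perm (Some e) * g) = letter_perm (Some (~~ b)) * f g.
  have : adj g ((f^-1) (letter_perm (Some (~~ b)) * f g)).
    by rewrite -(graph_autP _ _ autf) permKV; apply/cayleyP; exists (Some (~~ b)).
  case/cayleyP=> -[e|] Ee; first by exists e; rewrite -Ee permKV.
  have := congr1 f Ee; rewrite permKV [RHS]fb => /mulIg/letter_perm_inj.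
  by case: (b).
(* These closed walks leave g by t and return along the c^e-edge, so their images begin and end with
   [Some b], which only [turn_word b] does. *)
have uniq w : word_perm (None :: rcons w (Some (~~ e))) = 1 -> size w = 10 ->
    path reduced_step None (rcons w (Some (~~ e))) ->
    image_word g (None :: rcons w (Some (~~ e))) = turn_word b.
  move=> w1 sz red; rewrite /= -/l El.
  apply: turn_word_unique.
  - by rewrite size_image_word size_rcons sz.
  - by rewrite -El; apply: (image_word_reduced g red).
  - have := @last_image_word g (None :: w) (Some (~~ e)) (Some b) None w1.
    by rewrite /= negbK -/l El; apply.
  - apply/eqP; rewrite -(inj_eq (mulIg (f g))) mul1g -El.
    by rewrite (word_perm_image g (None :: _)) w1 mul1g.
have E := uniq [:: Some e; None; Some (~~ e); None; Some e; None;
                   Some (~~ e); None; Some e; None] (braid_word1 e) erefl.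
have E' := uniq [:: Some e; Some e; None; Some (~~ e); Some (~~ e); None;
                    Some e; Some e; None; Some (~~ e)]
             (commutation_word1 e) erefl.
have /image_word_inj :
    image_word g (braid_word e) = image_word g (commutation_word e).
  by rewrite [LHS]E ?[RHS]E' //; case: (e).
by case: (e).
Qed.

(** * Constancy of the direction of the c-edges *)

Definition preserves_dir g := f (c * g) == c * f g.

(** The t-edge at [f g] is taken by the image of the t-edge at g, so by injectivity the two c-edges
    at g go to the two c-edges at [f g], in one order or the other. *)
Lemma image_ncycle g b :
  f (letter_perm (Some b) * g) = letter_perm (Some (b == preserves_dir g)) * f g.
Proof.
have ne b' : edge_label (f g) (f (letter_perm (Some b') * g)) != None.
  apply/eqP => E; have := image_edge g (Some b'); rewrite E -image_transp12.
  by move/perm_inj/mulIg/(@letter_perm_inj (Some b') None).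
have := image_edge g (Some true); have := ne true.
have := image_edge g (Some false); have := ne false.
case: (edge_label _ _) => [b1|] // _ E1; case: (edge_label _ _) => [b2|] // _ E2.
have b12 : b1 != b2.
  apply/eqP => Eb; move: E1; rewrite Eb -E2.
  by move=> /perm_inj/mulIg/letter_perm_inj.
have -> : preserves_dir g = b2.
  rewrite /preserves_dir [f _]E2 (inj_eq (@mulIg _ _)).
  by rewrite -[c]/(letter_perm (Some true)) (inj_eq letter_perm_inj); case: (b2).
by case: b; rewrite ?E1 ?E2; case: (b1) (b2) b12 => [] [].
Qed.

(** Read backwards, an edge carries the inverse label, and so does its image; hence both ends see
    the same direction. *)
Lemma preserves_dir_ncycle g b :
  preserves_dir (letter_perm (Some b) * g) = preserves_dir g.
Proof.
have := image_ncycle (letter_perm (Some b) * g) (~~ b).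
rewrite [f (letter_perm (Some b) * g)]image_ncycle.
rewrite -[Some (~~ b)]/(linv (Some b)) letter_perm_linv mulKg mulgA.
rewrite -[LHS]mul1g => /mulIg/esym/eqP.
rewrite -eq_invg_mul eq_sym -letter_perm_linv => /eqP/letter_perm_inj.
by case: b; case: preserves_dir; case: preserves_dir.
Qed.

Lemma image_word_transp12_ncycle g b w :
  image_word g [:: None, Some b & w]
  = [:: None, Some (b == preserves_dir (t * g))
      & image_word (letter_perm (Some b) * (t * g)) w].
Proof.
rewrite [LHS]/= -![if b then _ else _]/(letter_perm (Some b)) image_ncycle.
by rewrite edge_labelE image_transp12 (edge_labelE _ None).
Qed.

Lemma preserves_dir_transp12 g : preserves_dir (t * g) = preserves_dir g.
Proof.
have w1 := braid_word1 true.
have := word_perm_image g (braid_word true); rewrite w1 mul1g -[RHS]mul1g.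
move/mulIg; rewrite [braid_word true]/alternating_word !image_word_transp12_ncycle.
(* The final c^-1 of the walk leads from v back to g, so v is [c * g] and has the direction of g. *)
move/alternating_word_closed; set v := (X in false == preserves_dir X).
rewrite -(preserves_dir_ncycle v false).
have -> : letter_perm (Some false) * v = g.
  by rewrite -[RHS]mul1g -w1 /v /= mul1g !mulgA.
by case: preserves_dir; case: preserves_dir.
Qed.

Lemma preserves_dir_const g : preserves_dir g = preserves_dir 1.
Proof.
elim/letter_perm_ind: g => // -[b|] h <-; first exact: preserves_dir_ncycle.
exact: preserves_dir_transp12.
Qed.

(** Both sides obey the same recursion along the generators, since conjugation by [phi] fixes t and
    inverts c. *)
Lemma graph_aut_shape g :
  f g = (if preserves_dir 1 then g else g ^ phi n) * f 1.
Proof.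
elim/letter_perm_ind: g => [|x h IH]; first by rewrite conj1g if_same mul1g.
case: x => [b|]; last first.
  by rewrite image_transp12 IH conjMg transp12J_phi; case: ifP; rewrite mulgA.
rewrite image_ncycle preserves_dir_const IH conjMg.
case: preserves_dir; rewrite mulgA; first by case: b.
by congr (_ * _ * _); case: b => /=; rewrite ?conjVg ncycleJ_phi ?invgK.
Qed.

End Automorphism.

(** * The automorphism group of the Cayley graph *)

Lemma conj_phi_neq1 : conj_aut [set: 'S_n] (phi n) != 1.
Proof.
apply/eqP => /permP/(_ c); rewrite conj_autTE perm1 ncycleJ_phi.
by move/(@letter_perm_inj (Some false) (Some true)).
Qed.

Lemma conj_phi_Aut_stab :
  conj_aut [set: 'S_n] (phi n) \in Aut_stab (conn_set n).
Proof.
rewrite inE Aut_aut /= eqEcard card_imset ?leqnn ?andbT; last exact: perm_inj.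
apply/subsetP => _ /imsetP[g + ->]; rewrite conj_autTE !inE -orbA.
case/or3P=> /eqP->; rewrite ?conjVg ?ncycleJ_phi ?transp12J_phi ?invgK eqxx;
  by rewrite ?orbT.
Qed.

(** A group automorphism fixes 1, so [graph_aut_shape] leaves only the identity and conjugation by
    [phi]. *)
Lemma Aut_stab_conn_set :
  Aut_stab (conn_set n) = <[conj_aut [set: 'S_n] (phi n)]>.
Proof.
apply/eqP; rewrite eqEsubset cycle_subG conj_phi_Aut_stab andbT.
apply/subsetP => f Af; have autf := subsetP (Aut_stab_sub_graph_aut _) f Af.
have f1 : f 1 = 1 by move: Af; rewrite inE => /andP[/AutT1].
have fE := graph_aut_shape autf; rewrite f1 in fE.
case: (preserves_dir f 1) fE => fE.
  by suff -> : f = 1 by []; apply/permP => g; rewrite fE mulg1 perm1.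
suff -> : f = conj_aut [set: 'S_n] (phi n) by apply: cycle_id.
by apply/permP => g; rewrite fE mulg1 conj_autTE.
Qed.

Lemma graph_aut_sdprod :
  right_regular 'S_n ><| Aut_stab (conn_set n) = graph_aut adj.
Proof.
rewrite sdprodE ?Aut_stab_norm_right_regular ?right_regular_Aut_stab_TI //.
apply/eqP; rewrite eqEsubset mul_subG ?right_regular_sub_graph_aut
  ?Aut_stab_sub_graph_aut //= -normC ?Aut_stab_norm_right_regular //.
apply/subsetP => f autf; have fE := graph_aut_shape autf.
(* With the factors swapped by [normC], f is the identity or conjugation by [phi], followed by right
   translation by [f 1]. *)
have Rf : right_mul (f 1) \in right_regular 'S_n by apply: imset_f.
case: (preserves_dir f 1) fE => fE.
  suff -> : f = 1 * right_mul (f 1) by apply: mem_mulg.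
  by apply/permP => g; rewrite mul1g right_mulE -fE.
suff -> : f = conj_aut [set: 'S_n] (phi n) * right_mul (f 1).
  by apply: mem_mulg; rewrite ?conj_phi_Aut_stab.
by apply/permP => g; rewrite permM right_mulE conj_autTE -fE.
Qed.

End CayleyWords.

Theorem theorem2p1 (n : nat) (hn : (13 <= n)%N) :
  [/\ right_regular 'S_n ><| Aut_stab (conn_set n)
        = graph_aut (cayley (conn_set n)),
      Aut_stab (conn_set n) = <[conj_aut [set: 'S_n] (phi n)]>,
      right_regular 'S_n ><| <[conj_aut [set: 'S_n] (phi n)]>
        = graph_aut (cayley (conn_set n))
    & graph_aut (cayley (conn_set n))
        \isog [set: sdprod_by (Z2_conj_groupAction (phi2 n))]].
Proof.
have defG := graph_aut_sdprod hn; have defA := Aut_stab_conn_set hn.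
have defGs := defG; rewrite defA in defGs.
by split=> //; apply: right_regular_sdprod_isog defGs; apply: conj_phi_neq1.
Qed.
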